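(* Let $n,k,\ell$ be integers with $2\leq \ell\leq n-1$ and $3\leq k\leq n$. Then $e_k(n,\ell,n-1)=n-1$.
   Context: All graphs are undirected, finite and simple. For a graph $G$ and a nonempty set $S\subseteq V(G)$, the Steiner distance $d_G(S)$ is the minimum number of edges of a connected subgraph (equivalently, a subtree) of $G$ whose vertex set contains $S$; set $d_G(S)=\infty$ if there is none. For $2\leq k\leq |V(G)|$, the Steiner $k$-diameter is $sdiam_k(G)=\max\{d_G(S): S\subseteq V(G),\ |S|=k\}$. For natural numbers $n,\ell,d$ with $d<n$, $\ell<n$, let $\mathscr{H}_k(n,\ell,d)$ be the set of all graphs $G$ of order $n$ with maximum degree exactly $\ell$ and $sdiam_k(G)\leq d$. Put $e_k(n,\ell,d)=\min\{|E(G)|: G\in \mathscr{H}_k(n,\ell,d)\}$, with $e_k(n,\ell,d)=\infty$ if $\mathscr{H}_k(n,\ell,d)=\emptyset$. *)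

(* Defs.v *)
(* Mathematical Components *)
From HB Require Import structures.
From mathcomp Require Import all_boot.

Set Implicit Arguments.
Unset Strict Implicit.
Unset Printing Implicit Defensive.

(* Natural numbers with infinity; [Infty] is the minimum of the empty family. *)
Inductive enat := Fin of nat | Infty.

Definition emin (x y : enat) : enat :=
  match x, y with
  | Fin m, Fin n => Fin (minn m n)
  | Infty, _ => y
  | _, Infty => x
  end.

Definition emax (x y : enat) : enat :=
  match x, y with
  | Fin m, Fin n => Fin (maxn m n)
  | _, _ => Infty
  end.

Definition ele (x y : enat) : bool :=
  match x, y with
  | _, Infty => true
  | Fin m, Fin n => m <= n
  | Infty, Fin _ => false
  end.

(* A graph with vertex set T, given by its set of edges: unordered pairs of
   distinct vertices.  The subtype of a finite type is again a finite type, so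
   that one can take minima over all graphs on T. *)
Record sgraph (T : finType) := SGraph {
  edges : {set {set T}};
  _ : [forall e in edges, #|e| == 2]
}.

HB.instance Definition _ (T : finType) := [isSub for @edges T].
HB.instance Definition _ (T : finType) := [Finite of sgraph T by <:].

Section Graphs.
Variables (T : finType).
Implicit Types (G : sgraph T) (W S : {set T}) (F : {set {set T}}).

Definition degree G (v : T) : nat := #|[set w | [set v; w] \in edges G]|.

Definition max_degree G : nat := \max_(v : T) degree G v.

(* The pair (W, F), with vertex set W and edge set F, is a subgraph of G. *)
Definition is_subgraph W F G : bool :=
  (F \subset edges G) && [forall e in F, e \subset W].

(* Since edges of a subgraph (W, F) have both ends in W, paths along F
   starting in W stay in W. *)
Definition is_connected W F : bool :=
  [forall x in W, forall y in W, connect [rel u v | [set u; v] \in F] x y].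

Definition steiner_distance G S : enat :=
  \big[emin/Infty]_(H : {set T} * {set {set T}}
                    | [&& is_subgraph H.1 H.2 G, is_connected H.1 H.2
                        & S \subset H.1])
     Fin #|H.2|.

(* Meaningful for 2 <= k <= #|T|: the maximum is then over a nonempty family,
   so the default value Fin 0 plays no role. *)
Definition sdiam (k : nat) G : enat :=
  \big[emax/Fin 0]_(S : {set T} | #|S| == k) steiner_distance G S.

End Graphs.

(* Graphs of order n are taken on the vertex set 'I_n; every graph of order n
   is isomorphic to one of these. *)
Definition Hset (k n l d : nat) : {set sgraph 'I_n} :=
  [set G | (max_degree G == l) && ele (sdiam k G) (Fin d)].

Definition e_min (k n l d : nat) : enat :=
  \big[emin/Infty]_(G in Hset k n l d) Fin #|edges G|.

(* Main.v *)
(** A graph whose Steiner [k]-diameter is finite is connected, because any two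
    vertices lie in a common [k]-set; hence it has at least [n - 1] edges.
    Conversely the broom (vertex [0] joined to [1, ..., l], followed by a path
    [l, l + 1, ..., n - 1]) is a tree of maximum degree [l], and any tree on [n]
    vertices has Steiner distances at most [n - 1]. *)
From HB Require Import structures.
Require Import Defs.
From mathcomp Require Import all_boot.
From mathcomp Require Import zify.

Set Implicit Arguments.
Unset Strict Implicit.
Unset Printing Implicit Defensive.

(** * Minima and maxima of extended naturals *)

Lemma eminA : associative emin.
Proof. by move=> [a|] [b|] [c|] //=; rewrite minnA. Qed.
Lemma eminC : commutative emin.
Proof. by move=> [a|] [b|] //=; rewrite minnC. Qed.
Lemma emin_infty : left_id Infty emin.
Proof. by case. Qed.
HB.instance Definition _ := Monoid.isComLaw.Build enat Infty emin eminA eminC emin_infty.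

Lemma emaxA : associative emax.
Proof. by move=> [a|] [b|] [c|] //=; rewrite maxnA. Qed.
Lemma emaxC : commutative emax.
Proof. by move=> [a|] [b|] //=; rewrite maxnC. Qed.
Lemma emax0 : left_id (Fin 0) emax.
Proof. by case=> //= a; rewrite max0n. Qed.
HB.instance Definition _ := Monoid.isComLaw.Build enat (Fin 0) emax emaxA emaxC emax0.

Lemma ele_trans : transitive ele.
Proof. by move=> [b|] [a|] [c|] //=; apply: leq_trans. Qed.

Lemma ele_anti : antisymmetric ele.
Proof. by move=> [a|] [b|] //= /anti_leq ->. Qed.

Section BigEnat.
Variables (I : finType) (P : pred I) (F : I -> enat).

Lemma bigemin_ele i : P i -> ele (\big[emin/Infty]_(j | P j) F j) (F i).
Proof.
move=> Pi; rewrite (bigD1 i) //=.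
by case: (F i) => [a|] //; case: (\big[_/_]_(_ | _) _) => [b|] //=; rewrite ?geq_minl.
Qed.

Lemma ele_bigemin x :
  (forall i, P i -> ele x (F i)) -> ele x (\big[emin/Infty]_(i | P i) F i).
Proof.
move=> xF; apply: (big_ind (ele x)) => //; first by case: x {xF}.
by case: x {xF} => [a|] [b|] [c|] //=; rewrite leq_min => -> ->.
Qed.

(** Over an empty family the minimum is the default [Infty], which no finite value bounds. *)
Lemma bigemin_fin_ex m :
  ele (\big[emin/Infty]_(i | P i) F i) (Fin m) -> exists i, P i.
Proof.
by case: (pickP P) => [i Pi _|P0]; [exists i | rewrite big_pred0].
Qed.

Lemma ele_bigemax i : P i -> ele (F i) (\big[emax/Fin 0]_(j | P j) F j).
Proof.
move=> Pi; rewrite (bigD1 i) //=.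
by case: (F i) => [a|] //; case: (\big[_/_]_(_ | _) _) => [b|] //=; rewrite ?leq_maxl.
Qed.

Lemma bigemax_ele m :
  (forall i, P i -> ele (F i) (Fin m)) ->
  ele (\big[emax/Fin 0]_(i | P i) F i) (Fin m).
Proof.
move=> Fm; apply: (big_ind (ele^~ (Fin m))) => //.
by move=> [b|] [c|] //=; rewrite geq_max => -> ->.
Qed.

End BigEnat.

(** * Connectivity, edge counting and Steiner diameter *)

Section Connectivity.
Variable T : finType.
Implicit Types (F : {set {set T}}) (W S A : {set T}) (G : sgraph T).

Definition adj F : rel T := [rel u v | [set u; v] \in F].

Lemma connect_adjC F : connect_sym (adj F).
Proof. by apply: sym_connect_sym => u v; rewrite /adj /= setUC. Qed.

(** Without such an edge, [A] would be closed under adjacency and would contain everything reachable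
    from [r], including [x]. *)
Lemma crossing_edge F A r x :
    (forall y, connect (adj F) r y) -> r \in A -> x \notin A ->
  exists u v, [/\ u \in A, v \notin A & [set u; v] \in F].
Proof.
move=> Fr rA xA.
case: (pickP [pred p : T * T | [&& p.1 \in A, p.2 \notin A & [set p.1; p.2] \in F]]).
  by case=> u v /and3P[uA vA uvF]; exists u, v.
move=> noedge.
have cA : closed (adj F) (mem A).
  apply: intro_closed; first exact: connect_adjC.
  move=> u v uv uA; apply: contraFT (noedge (u, v)) => vA.
  by rewrite /= uA vA.
by have := closed_connect cA (Fr x); rewrite rA (negbTE xA).
Qed.

(* Grow a vertex set from [r], one crossing edge at a time. *)
Lemma growing_set F r m :
    (forall y, connect (adj F) r y) -> m < #|T| ->
  exists A, [/\ r \in A, #|A| = m.+1 & m <= #|[set e in F | e \subset A]|].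
Proof.
move=> Fr; elim: m => [|m IHm] mT.
  by exists [set r]; rewrite set11 cards1.
have [A [rA cardA leA]] := IHm (ltnW mT).
have [x xA] : exists x, x \notin A.
  apply/existsP; rewrite -negb_forall; apply/negP => /forallP allA.
  have AT : A = setT by apply/setP=> y; rewrite inE allA.
  by move: mT; rewrite -cardA AT cardsT ltnn.
have [u [v [uA vA uvF]]] := crossing_edge Fr rA xA.
exists (v |: A); rewrite cardsU1 vA cardA inE rA orbT; split=> //.
have uvA : [set u; v] \notin [set e in F | e \subset A].
  by rewrite inE subUset !sub1set (negbTE vA) !andbF.
apply: (@leq_trans #|[set u; v] |: [set e in F | e \subset A]|).
  by rewrite cardsU1 uvA.
apply: subset_leq_card; apply/subsetP => e; rewrite !inE => /orP[/eqP->|].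
  by rewrite uvF subUset !sub1set !inE uA eqxx orbT.
case/andP=> -> /subset_trans; apply; exact: subsetUr.
Qed.

(** Growing from [r] until all of [T] is covered takes [#|T|.-1] steps, each contributing a new edge
    of [F]. *)
Lemma connected_card_edges F r :
  (forall y, connect (adj F) r y) -> #|T| <= #|F|.+1.
Proof.
move=> Fr; have T0 : 0 < #|T| by apply/card_gt0P; exists r.
have [|A [_ _ le]] := @growing_set F r #|T|.-1 Fr; first by rewrite prednK.
rewrite -(prednK T0) ltnS; apply: leq_trans le _.
by apply: subset_leq_card; apply/subsetP => e; rewrite inE => /andP[].
Qed.

Lemma superset_of_card (A : {set T}) k :
  #|A| <= k <= #|T| -> exists2 S : {set T}, A \subset S & #|S| = k.
Proof.
case/andP; elim: k => [|k IHk] Ak kT.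
  by exists A => //; apply/eqP; rewrite -leqn0.
move: Ak; rewrite leq_eqVlt => /orP[/eqP Ak|Ak]; first by exists A.
have [S AS cardS] := IHk Ak (ltnW kT).
have /card_gt0P[x] : 0 < #|~: S| by rewrite cardsCs setCK cardS subn_gt0.
rewrite inE => xS; exists (x |: S); last by rewrite cardsU1 xS cardS.
exact: subset_trans AS (subsetUr _ _).
Qed.

Lemma sdiam_fin_connected G k m x y :
  2 <= k <= #|T| -> ele (sdiam k G) (Fin m) -> connect (adj (edges G)) x y.
Proof.
case/andP=> k2 kT Gm.
(* As [k] is at least 2, the pair fits into a [k]-set [S]. The finite Steiner distance of [S] then
   yields a connected subgraph joining [x] to [y]. *)
have [|S xyS cardS] := @superset_of_card [set x; y] k.
  by rewrite kT (leq_trans _ k2) // cards2 ltnS leq_b1.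
have Sk : #|S| == k by apply/eqP.
have /bigemin_fin_ex[[W F] /and3P[/andP[/= FG _] conn SW]] :
    ele (steiner_distance G S) (Fin m).
  exact: ele_trans (@ele_bigemax _ _ (steiner_distance G) S Sk) Gm.
move: (subset_trans xyS SW); rewrite subUset !sub1set => /andP[xW yW].
have := forall_inP (forall_inP conn x xW) y yW.
apply: connect_sub => u v /= uv; apply: connect1.
exact: (subsetP FG).
Qed.

(** The whole graph is a connected subgraph containing every [S], so it competes in each Steiner
    distance. For a tree this bound is the order minus one. *)
Lemma connected_sdiam_le G k :
    (forall x y, connect (adj (edges G)) x y) ->
  ele (sdiam k G) (Fin #|edges G|).
Proof.
move=> conn; apply: bigemax_ele => S _.
apply: (@bigemin_ele _ _ (fun H : {set T} * {set {set T}} => Fin #|H.2|)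
          (setT, edges G)).
rewrite /= subsetT andbT; apply/andP; split.
  by apply/andP; split=> //=; apply/forall_inP=> e _; rewrite subsetT.
by apply/forall_inP=> x _; apply/forall_inP=> y _; apply: conn.
Qed.

End Connectivity.

(** * The broom: an extremal tree of maximum degree [l] *)

Section Broom.
Variables (n l : nat).

(** The tree is encoded by parent pointers towards the root 0. The root is its own parent, so edges
    are indexed by nonzero vertices only. *)
Definition broom_parent (i : 'I_n.+1) : 'I_n.+1 :=
  inord (if i <= l then 0 else i.-1).

Lemma broom_parentE i : broom_parent i = (if i <= l then 0 else i.-1) :> nat.
Proof. rewrite inordK //; have := ltn_ord i; case: ifP; lia. Qed.

Lemma broom_parent_lt i : i != ord0 -> broom_parent i < i.
Proof. rewrite broom_parentE -val_eqE /=; case: ifP; lia. Qed.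

Definition broom_edges : {set {set 'I_n.+1}} :=
  [set [set i; broom_parent i] | i in [set~ ord0]].

Lemma broom_edges_card2 : [forall e in broom_edges, #|e| == 2].
Proof.
apply/forall_inP => e /imsetP[i]; rewrite !inE => i0 ->.
have := broom_parent_lt i0; rewrite cards2.
by rewrite ltn_neqAle (eq_sym i) => /andP[+ _]; rewrite val_eqE => ->.
Qed.

Definition broom := SGraph broom_edges_card2.

Lemma broom_edges_leq : #|edges broom| <= n.
Proof. by apply: leq_trans (leq_imset_card _ _) _; rewrite cardsC1 card_ord. Qed.

Lemma broom_edgeP v w :
  reflect ((v != ord0 /\ w = broom_parent v) \/ (w != ord0 /\ v = broom_parent w))
          ([set v; w] \in edges broom).
Proof.
apply: (iffP imsetP) => [[i]|[[v0 ->]|[w0 ->]]].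
- rewrite !inE => i0 e; have ilt := broom_parent_lt i0.
  have: v \in [set i; broom_parent i] by rewrite -e set21.
  have: w \in [set i; broom_parent i] by rewrite -e set22.
  have: i \in [set v; w] by rewrite e set21.
  have: broom_parent i \in [set v; w] by rewrite e set22.
  (* Of the four ways to match the two pairs, those with [v = w] would make [i] its own parent,
     against [ilt]. *)
  rewrite !inE => pi ii /orP[/eqP wi|/eqP wi] /orP[/eqP vi|/eqP vi].
  + by move: pi ilt; rewrite vi wi orbb => /eqP ->; rewrite ltnn.
  + by right; rewrite wi.
  + by left; rewrite vi.
  + by move: ii ilt; rewrite vi wi orbb => /eqP <-; rewrite ltnn.
- by exists v; rewrite ?inE.
- by exists w; rewrite ?inE // setUC.
Qed.

Lemma broom_connect0 v : connect (adj (edges broom)) v ord0.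
Proof.
have [m] := ubnP (v : nat); elim: m v => // m IHm v vm.
have [->|v0] := eqVneq v ord0; first exact: connect0.
have pv : adj (edges broom) v (broom_parent v) by apply/broom_edgeP; left.
apply: connect_trans (connect1 pv) (IHm _ _).
exact: leq_trans (broom_parent_lt v0) vm.
Qed.

Lemma broom_connected x y : connect (adj (edges broom)) x y.
Proof.
apply: connect_trans (broom_connect0 x) _.
by rewrite connect_adjC broom_connect0.
Qed.

Hypotheses (l2 : 2 <= l) (ln : l <= n).

Lemma broom_degree0 : degree broom ord0 = l.
Proof.
have pS (i : 'I_l) : i.+1 < n.+1 by have := ltn_ord i; lia.
(* The neighbours of the root are exactly 1, ..., [l], the image of ['I_l] under this shift. *)
pose f (i : 'I_l) := Ordinal (pS i).
have f_inj : injective f by move=> i j /(congr1 val) [] /val_inj.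
rewrite -[RHS]card_ord -cardsT -(card_imset _ f_inj); apply: eq_card => w.
rewrite inE; apply/broom_edgeP/imsetP => [[[]|[]]|[i _ ->]] //.
- move=> w0 /(congr1 val); rewrite /= broom_parentE => pw.
  have wl : w.-1 < l by move: w0 pw; rewrite -val_eqE /=; case: ifP; lia.
  exists (Ordinal wl) => //; apply: val_inj => /=.
  by move: w0; rewrite -val_eqE /=; lia.
- right; split=> //; apply: val_inj; rewrite /= broom_parentE /=.
  by rewrite ltn_ord.
Qed.

(** A child of a nonzero vertex lies beyond [l], so it can only be the successor. At the last vertex
    [inord v.+1] falls back to 0, which is harmless for an upper bound. *)
Lemma broom_degree_le2 v : v != ord0 -> degree broom v <= 2.
Proof.
move=> v0; apply: (@leq_trans #|[set broom_parent v; inord v.+1]|); last first.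
  by rewrite cards2 ltnS leq_b1.
apply: subset_leq_card; apply/subsetP=> w; rewrite !inE.
case/broom_edgeP=> [[_ ->]|[w0 vw]]; first by rewrite eqxx.
apply/orP; right; apply/eqP/val_inj => /=.
have vE : v = w.-1 :> nat.
  move/(congr1 val): vw; rewrite /= broom_parentE.
  by move: v0; rewrite -val_eqE /=; case: ifP; lia.
by rewrite inordK; move: w0 (ltn_ord w); rewrite -val_eqE /=; lia.
Qed.

Lemma broom_max_degree : max_degree broom = l.
Proof.
apply/eqP; rewrite eqn_leq; apply/andP; split.
  apply/bigmax_leqP => v _; have [->|v0] := eqVneq v ord0.
    by rewrite broom_degree0.
  (* Here [2 <= l] keeps the path vertices from exceeding the degree of the root. *)
  exact: leq_trans (broom_degree_le2 v0) l2.
by rewrite -{1}broom_degree0; apply: leq_bigmax.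
Qed.

End Broom.

Theorem theorem2p1 (n k l : nat) (hl2 : 2 <= l) (hln : l <= n - 1)
    (hk3 : 3 <= k) (hkn : k <= n) :
  e_min k n l (n - 1) = Fin (n - 1).
Proof.
case: n hln hkn => [|n]; first by case: l hl2.
rewrite subSS subn0 => hln hkn; apply: ele_anti; apply/andP; split.
  (* Upper bound: the broom belongs to the family; its edge count bounds both its Steiner diameter
     and the minimum. *)
  apply: (@ele_trans (Fin #|edges (broom n l)|)); last exact: broom_edges_leq.
  apply: (@bigemin_ele _ _ (fun G => Fin #|edges G|)).
  rewrite inE broom_max_degree // eqxx /=.
  apply: ele_trans (connected_sdiam_le _ (@broom_connected n l)) _.
  exact: broom_edges_leq.
(* Lower bound: every member has finite Steiner diameter, hence is connected, hence has at least [n]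
   edges on its [n.+1] vertices. *)
apply: ele_bigemin => G; rewrite inE => /andP[_ Gn] /=.
rewrite -ltnS -[X in X <= _]card_ord.
apply: (@connected_card_edges _ _ ord0) => y.
by apply: sdiam_fin_connected Gn; rewrite card_ord hkn (ltnW hk3).
Qed.
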